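(* Let $s\in(0,1)$ and $n\ge1$. There exists a constant $c=c(n,s)>0$ with the following property. Let $\Omega\subset\mathbb{R}^n$ be open and let $E\subset\mathbb{R}^n$ be a subsolution in $\Omega$. If $x\in\partial E$ and $B_r(x)\subset\Omega$, then $$|E\cap B_r(x)|\ge c\,r^n.$$ In particular, if $E$ is $s$-minimal in $\Omega$, $x\in\partial E$ and $B_r(x)\subset\Omega$, then $$|E\cap B_r(x)|\ge c\,r^n,\qquad |\mathcal{C}E\cap B_r(x)|\ge c\,r^n.$$
   Context: $\mathcal{C}E$ is the complement; $|\cdot|$ is Lebesgue measure. For disjoint measurable $A,B$, $\mathcal{L}_s(A,B):=\int_A\int_B\frac{dx\,dy}{|x-y|^{n+s}}$, and $P_s(E,\Omega):=\mathcal{L}_s(E\cap\Omega,\mathcal{C}E)+\mathcal{L}_s(E\setminus\Omega,\mathcal{C}E\cap\Omega)$. $E$ is $s$-minimal in $\Omega$ if $P_s(E,\Omega)<\infty$ and $P_s(E,\Omega)\le P_s(F,\Omega)$ for every measurable $F$ with $F\setminus\Omega=E\setminus\Omega$. $E$ is a (variational) subsolution in $\Omega$ if for every measurable $A\subset E\cap\Omega$ one has $\mathcal{L}_s(A,E\setminus A)-\mathcal{L}_s(A,\mathcal{C}E)\ge0$, i.e. $\mathcal{L}_s(A,\mathcal{C}E)\le\mathcal{L}_s(A,E\setminus A)$. Standing convention: every set $E$ is modified on a null set so that $E_1\subset E$ and $E\cap E_0=\emptyset$, where $E_1=\{x:\exists r>0,\ |E\cap B_r(x)|=\omega_nr^n\}$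 and $E_0=\{x:\exists r>0,\ |E\cap B_r(x)|=0\}$, and so that $\partial E=\{x: 0<|E\cap B_r(x)|<\omega_nr^n\ \forall r>0\}$; $\omega_n=|B_1|$. *)

(* Defs.v *)
From HB Require Import structures.
From mathcomp Require Import all_boot all_order all_algebra.
From mathcomp Require Import all_classical all_reals all_analysis.

Set Implicit Arguments.
Unset Strict Implicit.
Unset Printing Implicit Defensive.

Import Order.TTheory GRing.Theory Num.Theory.
Import numFieldNormedType.Exports.

Local Open Scope classical_set_scope.
Local Open Scope ring_scope.

(** R^n is ['rV[R]_n].  The library has no n-dimensional Lebesgue measure: it
    is built here as the n-fold product of the one-dimensional one on the
    product Borel sigma-algebra, and then completed. *)

Section rV_measurable.
Context {R : realType} (n : nat).

Definition rV_coord (i : 'I_n) (x : 'rV[R]_n) : measurableTypeR R := x 0 i.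

Let rV_set0 : g_sigma_preimage rV_coord set0.
Proof. exact: sigma_algebra0. Qed.

Let rV_setC A : g_sigma_preimage rV_coord A -> g_sigma_preimage rV_coord (~` A).
Proof. exact: sigma_algebraC. Qed.

Let rV_bigcup (F : _^nat) : (forall i, g_sigma_preimage rV_coord (F i)) ->
  g_sigma_preimage rV_coord (\bigcup_i (F i)).
Proof. exact: sigma_algebra_bigcup. Qed.

Fact rV_display : measure_display. Proof. exact: default_measure_display. Qed.

HB.instance Definition _ := @isMeasurable.Build rV_display 'rV[R]_n
  (g_sigma_preimage rV_coord) rV_set0 rV_setC rV_bigcup.

Lemma measurable_rV_coord i : measurable_fun setT (rV_coord i).
Proof.
move=> _ Y mY; rewrite setTI; apply: sub_sigma_algebra => /=.
rewrite -bigcup_seq/=; exists i => /=; first by rewrite mem_index_enum.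
by exists Y => //; rewrite setTI.
Qed.

Lemma measurable_fun_rV d (T : measurableType d) (f : T -> 'rV[R]_n) :
  (forall i, measurable_fun setT (rV_coord i \o f)) -> measurable_fun setT f.
Proof.
move=> mf _ A mA; rewrite setTI.
suff H : g_sigma_preimage (fun i => rV_coord i \o f) `<=` measurable.
  by apply: H; rewrite g_sigma_preimage_comp; exists A => //; rewrite setTI.
apply: smallest_sub; first exact: sigma_algebra_measurable.
rewrite -bigcup_seq => B /= [i _] [Y mY <-].
exact: mf.
Qed.

End rV_measurable.

Section rV_cons.
Context {R : realType} (n : nat).

Definition rV_cons (p : measurableTypeR R * 'rV[R]_n) : 'rV[R]_n.+1 :=
  row_mx (const_mx (p.1 : R)) p.2 : 'rV_(1 + n).

Definition rV_uncons (x : 'rV[R]_n.+1) : measurableTypeR R * 'rV[R]_n :=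
  (x 0 0, rsubmx (x : 'rV_(1 + n))).

Lemma rV_cons_head p (i : 'I_1) : rV_cons p 0 (lshift n i) = p.1.
Proof. by rewrite [LHS](@row_mxEl _ 1 1 n) mxE. Qed.

Lemma rV_cons_tail p (i : 'I_n) : rV_cons p 0 (rshift 1 i) = p.2 0 i.
Proof. exact: (@row_mxEr _ 1 1 n). Qed.

Lemma rV_consK : cancel rV_cons rV_uncons.
Proof.
move=> [a v]; rewrite /rV_uncons; congr pair; last by rewrite /rV_cons row_mxKr.
rewrite (_ : (0 : 'I_n.+1) = lshift n (0 : 'I_1)); last exact: val_inj.
exact: rV_cons_head.
Qed.

Lemma measurable_rV_cons : measurable_fun setT rV_cons.
Proof.
apply: measurable_fun_rV => i.
case: (@splitP 1 n i) => j ij.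
  rewrite (_ : _ \o _ = fst); first exact: measurable_fst.
  apply/funext => p; rewrite /= /rV_coord.
  by rewrite (_ : i = lshift n j) ?rV_cons_head//; exact: val_inj.
rewrite (_ : _ \o _ = rV_coord j \o snd).
  by apply: measurableT_comp => //; exact: measurable_rV_coord.
apply/funext => p; rewrite /= /rV_coord.
by rewrite (_ : i = rshift 1 j) ?rV_cons_tail//; exact: val_inj.
Qed.

Lemma measurable_rV_uncons : measurable_fun setT rV_uncons.
Proof.
apply/measurable_fun_pair => /=; first exact: (measurable_rV_coord ord0).
apply: measurable_fun_rV => i.
rewrite (_ : _ \o _ = rV_coord (rshift 1 i : 'I_n.+1)).
  exact: measurable_rV_coord.
by apply/funext => x; rewrite /= /rV_coord mxE.
Qed.

Variable mu : {sigma_finite_measure set 'rV[R]_n -> \bar R}.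

Definition lebesgue_rV_cons : set 'rV[R]_n.+1 -> \bar R :=
  pushforward (lebesgue_measure \x mu)%E rV_cons.

Let cons0 : lebesgue_rV_cons set0 = 0%E.
Proof. by have mf := measurable_rV_cons; exact: measure0. Qed.

Let cons_ge0 A : (0 <= lebesgue_rV_cons A)%E.
Proof. by have mf := measurable_rV_cons; exact: measure_ge0. Qed.

Let cons_sigma_additive : semi_sigma_additive lebesgue_rV_cons.
Proof.
by have mf := measurable_rV_cons; exact: measure_semi_sigma_additive.
Qed.

HB.instance Definition _ := isMeasure.Build _ _ _ lebesgue_rV_cons
  cons0 cons_ge0 cons_sigma_additive.

Let cons_sigma_finite : sigma_finite setT lebesgue_rV_cons.
Proof.
have /sigma_finiteP[A [TA ndA Aoo]] := sigma_finiteT (@lebesgue_measure R).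
have /sigma_finiteP[B [TB ndB Boo]] := sigma_finiteT mu.
have [F TF mF] : sigma_finite setT (@lebesgue_measure R \x mu)%E.
  exists (fun k => A k `*` B k).
    rewrite -setXTT TA TB predeqE => -[x y]; split.
      move=> [/= [i _ Aix] [k _ Bky]]; exists (maxn i k) => //; split.
      - by move: x Aix; exact/subsetPset/ndA/leq_maxl.
      - by move: y Bky; exact/subsetPset/ndB/leq_maxr.
    by move=> [i _ []/= ? ?]; split; exists i.
  move=> k; have [? ?] := Aoo k; have [? ?] := Boo k.
  split; first exact: measurableX.
  by rewrite product_measure1E// lte_mul_pinfty// ge0_fin_numE.
exists (fun k => rV_uncons @^-1` F k).
  by rewrite -preimage_bigcup -TF preimage_setT.
move=> k; have [mFk Fk] := mF k; split.
  by rewrite -[X in measurable X]setTI; exact: measurable_rV_uncons.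
rewrite /lebesgue_rV_cons /pushforward -comp_preimage.
by rewrite (_ : _ \o _ = id)//; apply/funext => p /=; rewrite rV_consK.
Qed.

HB.instance Definition _ := Measure_isSigmaFinite.Build _ _ _ lebesgue_rV_cons
  cons_sigma_finite.

End rV_cons.

Fixpoint borel_lebesgue_rV (R : realType) (n : nat) :
    {sigma_finite_measure set 'rV[R]_n -> \bar R} :=
  match n with
  | 0 => \d_(0 : 'rV[R]_0)
  | n'.+1 => lebesgue_rV_cons (borel_lebesgue_rV R n')
  end.

Definition lebesgue_rV (R : realType) (n : nat) :=
  @completed_measure_extension _ _ R (borel_lebesgue_rV R n).
Arguments lebesgue_rV : clear implicits.

HB.instance Definition _ (R : realType) (n : nat) :=
  Measure.on (@lebesgue_rV R n).

Section fractional_perimeter.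
Context {R : realType} {n : nat}.
Implicit Types (A B E F Omega : set 'rV[R]_n) (x y : 'rV[R]_n) (r s : R).

Definition lebesgue_measurable A : Prop :=
  ((borel_lebesgue_rV R n)^*)%mu.-cara.-measurable A.

Definition vol A : \bar R := lebesgue_rV R n A.

(** The library norm on ['rV[R]_n] is the sup norm (which induces the same
    topology). *)
Definition enorm x : R := Num.sqrt (\sum_(i < n) x 0 i ^+ 2).

Definition eball x r : set 'rV[R]_n := [set y | enorm (y - x) < r].

(** On the diagonal this is [0^-1 = 0]; [interaction] below is only used on
    disjoint sets, where [x != y]. *)
Definition frac_kernel s x y : \bar R :=
  ((enorm (x - y) `^ (n%:R + s))^-1)%:E.

Definition interaction s A B : \bar R :=
  (\int[lebesgue_rV R n]_(x in A) \int[lebesgue_rV R n]_(y in B)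
     frac_kernel s x y)%E.

Definition perimeter s E Omega : \bar R :=
  (interaction s (E `&` Omega) (~` E)
   + interaction s (E `\` Omega) (~` E `&` Omega))%E.

Definition s_minimal s E Omega : Prop :=
  (perimeter s E Omega < +oo)%E /\
  forall F, lebesgue_measurable F -> F `\` Omega = E `\` Omega ->
    (perimeter s E Omega <= perimeter s F Omega)%E.

(** Stated without subtraction, since both interactions may be infinite. *)
Definition subsolution s E Omega : Prop :=
  forall A, lebesgue_measurable A -> A `<=` E `&` Omega ->
    (interaction s A (~` E) <= interaction s A (E `\` A))%E.

Definition ball_vol r : \bar R := (vol (eball 0 1) * (r ^+ n)%:E)%E.

Definition density1 E : set 'rV[R]_n :=
  [set x | exists2 r, 0 < r & vol (E `&` eball x r) = ball_vol r].

Definition density0 E : set 'rV[R]_n :=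
  [set x | exists2 r, 0 < r & vol (E `&` eball x r) = 0%E].

Definition topological_boundary E : set 'rV[R]_n := closure E `\` E°.

(** The standing choice of representative of a measurable set. *)
Definition normalized E : Prop :=
  [/\ density1 E `<=` E,
      E `&` density0 E = set0 &
      topological_boundary E =
        [set x | forall r, 0 < r ->
           (0 < vol (E `&` eball x r) < ball_vol r)%E]].

End fractional_perimeter.

(* Main.v *)
(** A direct De Giorgi argument. Put [A = E `&` B_rho(x)]. Since [E] is a
    subsolution, [L(A, ~` A) <= 2 L(A, E `\` A) <= 2 L(A, ~` B_rho(x))]. At each
    point of [A] the potential of [~` A] is at least [w / 2 * R `^ (- s)] as soon
    as [|A| <= w / 2 * R ^ n] (compare with a ball of radius [R]), while the
    potential of [~` B_rho(x)] at [y] is at most [C (rho - |y - x|) `^ (- s)].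
    This singularity is integrable in [rho], so averaging over [rho] in ]a, b[
    yields [|E `&` B_a| <= C (R / (b - a)) `^ s |E `&` B_b|] whenever
    [|E `&` B_b| <= w / 2 * R ^ n].
    On the radii [r / 2 * (1 + 2 ^- k)] with [R = eps r 2 ^- k], the quotient
    [R / (b - a)] is [4 eps] for all [k]. For small [eps] each step therefore
    gains a factor [2 ^- n], and if [|E `&` B_r|] were below [c r ^ n] then
    [|E `&` B_(r / 2)|] would vanish.
    For a minimizer, comparing [E] with [E `\` A] shows that [E] is a
    subsolution; the perimeter being invariant under complementation, so is
    [~` E]. *)

Require Import Defs.
From HB Require Import structures.
From mathcomp Require Import all_boot all_order all_algebra.
From mathcomp Require Import all_classical all_reals all_analysis.
From mathcomp Require Import measurable_realfun ring lra.

Set Implicit Arguments.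
Unset Strict Implicit.
Unset Printing Implicit Defensive.

Import Order.TTheory GRing.Theory Num.Theory.
Import numFieldNormedType.Exports.

Local Open Scope classical_set_scope.
Local Open Scope ring_scope.

(** * Affine maps and cubes *)

(** The uniqueness theorems for Lebesgue measure and for product measures compare measures, so the
    rescaled image measure is packaged as one, specified by its values. *)
Lemma ge0_mscale_pushforward d d' (T1 : measurableType d) (T2 : measurableType d')
  (R : realType) (m : {measure set T1 -> \bar R}) (f : T1 -> T2) (c : R) :
  measurable_fun setT f -> 0 <= c ->
  exists mu : {measure set T2 -> \bar R}, forall A, mu A = (c%:E * m (f @^-1` A))%E.
Proof.
move=> mf c0.
by unshelve eexists (mscale (NngNum c0) (pushforward m f)).
Qed.

Section affine.
Context {R : realType}.

(** Both sides are measures in [A] that agree on half-open intervals, so uniqueness of Lebesgue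
    measure applies. *)
Lemma lebesgue_measure_affine (b r : R) A : 0 < r -> measurable A ->
  (r%:E * lebesgue_measure ((fun u => b + r * u)%R @^-1` A))%E =
  lebesgue_measure (A : set (measurableTypeR R)).
Proof.
move=> r0 mA.
have mf : measurable_fun setT
    (fun u : measurableTypeR R => b + r * u : measurableTypeR R).
  apply: measurable_funD => //; exact: measurable_funM.
have [mu muE] := ge0_mscale_pushforward (@lebesgue_measure R) mf (ltW r0).
rewrite -[LHS]muE; apply/esym/lebesgue_measure_unique => //.
move=> _ [[x y] _ <-] /=; rewrite muE lebesgue_measure_itv/= lte_fin.
rewrite (_ : _ @^-1` _ = `](x - b) / r, (y - b) / r]%classic); last first.
  apply/seteqP; split => u/=; rewrite !in_itv/= ltr_pdivrMr// ler_pdivlMr//.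
    by move=> /andP[xu uy]; apply/andP; split; lra.
  by move=> /andP[xu uy]; apply/andP; split; lra.
rewrite lebesgue_measure_itv/= lte_fin ltr_pM2r ?invr_gt0// ltrD2r.
case: ifP => _; last by rewrite mule0.
by rewrite -!EFinB -EFinM; congr EFin; field; rewrite gt_eqF.
Qed.

Lemma measurable_affine_rV n (b : 'rV[R]_n) (r : R) :
  measurable_fun setT (fun x : 'rV[R]_n => b + r *: x).
Proof.
apply: measurable_fun_rV => i.
rewrite (_ : _ \o _ = (fun x => b 0 i + r * rV_coord i x)); last first.
  by apply/funext => x; rewrite /= /rV_coord !mxE.
apply: (@measurable_funD _ _ R) => //; apply: (@measurable_funM _ _ R) => //.
exact: measurable_rV_coord.
Qed.

Lemma rV_cons_affine n (b : 'rV[R]_n.+1) (r : R) p :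
  b + r *: rV_cons p = rV_cons (b 0 0 + r * p.1, rsubmx (b : 'rV_(1 + n)) + r *: p.2).
Proof.
apply/rowP => i; rewrite !mxE.
case: (@splitP 1 n i) => j ij.
  rewrite (_ : i = lshift n j) ?rV_cons_head//=; last exact: val_inj.
  rewrite !mxE (_ : lshift n j = 0) //; apply/val_inj => /=; by case: j {ij} => -[].
rewrite (_ : i = rshift 1 j) ?rV_cons_tail//=; last exact: val_inj.
by rewrite !mxE.
Qed.

(** Induction on [n]: through [rV_cons] the map becomes a product of affine maps, one of the line
    and one of the remaining coordinates, and by uniqueness of product measures it suffices to check
    rectangles. *)
Lemma borel_lebesgue_rV_affine n (b : 'rV[R]_n) (r : R) A : 0 < r -> measurable A ->
  ((r ^+ n)%:E * borel_lebesgue_rV R n ((fun x => b + r *: x)%R @^-1` A))%E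
  = borel_lebesgue_rV R n A.
Proof.
move=> r0; elim: n b A => [|n IH] b A mA.
  rewrite expr0 mul1e; congr (_ _); apply/seteqP; split => x/=.
    by rewrite (_ : _ + _ = x)//; apply/rowP => -[].
  by rewrite (_ : _ + _ = x)//; apply/rowP => -[].
rewrite /= /lebesgue_rV_cons /pushforward.
pose phi (p : measurableTypeR R * 'rV[R]_n) : measurableTypeR R * 'rV[R]_n :=
  (b 0 0 + r * p.1, rsubmx (b : 'rV_(1 + n)) + r *: p.2).
have mphi : measurable_fun setT phi.
  apply/measurable_fun_pair => /=.
    by apply: (@measurable_funD _ _ R) => //; apply: (@measurable_funM _ _ R) => //.
  apply: (measurableT_comp (measurable_affine_rV _ _)) => //.
have [mu muE] := ge0_mscale_pushforward
  (lebesgue_measure \x borel_lebesgue_rV R n)%E mphi (ltW (exprn_gt0 n.+1 r0)).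
have E : phi @^-1` (@rV_cons R n @^-1` A)
    = @rV_cons R n @^-1` ((fun x => b + r *: x) @^-1` A).
  by apply/funext => p; rewrite /preimage /mkset rV_cons_affine.
rewrite -E -[LHS]muE.
apply/esym/product_measure_unique; last first.
  by rewrite -[X in measurable X]setTI; exact: measurable_rV_cons.
move=> B C mB mC; rewrite [LHS]muE.
rewrite (_ : phi @^-1` _ = ((fun u => b 0 0 + r * u)%R @^-1` B) `*`
  ((fun x => rsubmx (b : 'rV_(1 + n)) + r *: x) @^-1` C)) //.
have mB' : measurable ((fun u => b 0 0 + r * u)%R @^-1` B : set (measurableTypeR R)).
  rewrite -[X in measurable X]setTI; apply: (_ : measurable_fun setT _) => //.
  by apply: (@measurable_funD _ _ R) => //; apply: (@measurable_funM _ _ R).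
have mC' : measurable ((fun x => rsubmx (b : 'rV_(1 + n)) + r *: x) @^-1` C).
  by rewrite -[X in measurable X]setTI; exact: measurable_affine_rV.
rewrite [X in (_ * X)%E](product_measure1E lebesgue_measure
  (borel_lebesgue_rV R n) mB' mC').
by rewrite exprS EFinM muleACA lebesgue_measure_affine// IH.
Qed.

(** Cubes serve to show that the unit ball has positive and finite volume. Measurability belongs to
    the induction because the product formula asks for it. *)
Lemma borel_lebesgue_rV_cube n (h : R) : 0 < h ->
  measurable [set x : 'rV[R]_n | forall i, `|x 0 i| < h] /\
  borel_lebesgue_rV R n [set x | forall i, `|x 0 i| < h] = ((h *+ 2) ^+ n)%:E.
Proof.
move=> h0; elim: n => [|n [mC IH]].
  rewrite (_ : [set _ | _] = setT); last by apply/seteqP; split => // x _ [].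
  by split => //; rewrite expr0 /= /dirac indicE mem_set// => -[].
have mB : measurable (ball (0:R) h : set (measurableTypeR R)).
  by apply: open_measurable; exact: ball_open.
have E : @rV_uncons R n @^-1`
    (ball (0:R) h `*` [set x : 'rV[R]_n | forall i, `|x 0 i| < h]) =
    [set x : 'rV[R]_n.+1 | forall i, `|x 0 i| < h].
  apply/seteqP; split => x/=.
    rewrite /ball/= sub0r normrN => -[x0 xS] i.
    case: (@splitP 1 n i) => j ij.
      by rewrite (_ : i = 0)//; apply/val_inj => /=; rewrite ij; case: j {ij} => -[].
    rewrite (_ : i = rshift 1 j); last exact: val_inj.
    by have := xS j; rewrite mxE.
  move=> xh; split; first by rewrite /ball/= sub0r normrN.
  by move=> i; rewrite mxE.
have mE : measurable (ball (0:R) h `*` [set x : 'rV[R]_n | forall i, `|x 0 i| < h]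
    : set (measurableTypeR R * _)).
  exact: measurableX.
split; first rewrite -E.
  by rewrite -[X in measurable X]setTI; exact: measurable_rV_uncons.
have E2 (S : set (measurableTypeR R * 'rV[R]_n)) :
    @rV_cons R n @^-1` (@rV_uncons R n @^-1` S) = S.
  by apply/funext => p; rewrite /preimage /mkset rV_consK.
transitivity (borel_lebesgue_rV R n.+1 (@rV_uncons R n @^-1`
    (ball (0:R) h `*` [set x : 'rV[R]_n | forall i, `|x 0 i| < h]))).
  by rewrite E.
rewrite /= /lebesgue_rV_cons /pushforward E2.
rewrite [LHS]product_measure1E// IH exprS EFinM; congr (_ * _)%E.
exact: lebesgue_measure_ball (ltW h0).
Qed.

End affine.

(** * The Euclidean norm *)

Section enorm.
Context {R : realType} {n : nat}.
Implicit Types x y : 'rV[R]_n.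

Lemma enorm_ge0 x : 0 <= enorm x. Proof. exact: sqrtr_ge0. Qed.

Lemma sqr_enorm x : enorm x ^+ 2 = \sum_(i < n) x 0 i ^+ 2.
Proof. by rewrite sqr_sqrtr// sumr_ge0// => i _; exact: sqr_ge0. Qed.

Lemma enormN x : enorm (- x) = enorm x.
Proof. by congr Num.sqrt; apply: eq_bigr => i _; rewrite mxE sqrrN. Qed.

Lemma enormZ (a : R) x : enorm (a *: x) = `|a| * enorm x.
Proof.
rewrite -sqrtr_sqr -sqrtrM ?sqr_ge0// mulr_sumr; congr Num.sqrt.
by apply: eq_bigr => i _; rewrite mxE exprMn.
Qed.

Lemma coord_le_enorm x i : `|x 0 i| <= enorm x.
Proof.
rewrite -sqrtr_sqr ler_wsqrtr// (bigD1 i)//= lerDl sumr_ge0// => j _.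
exact: sqr_ge0.
Qed.

Lemma enorm_eq0 x : (enorm x == 0) = (x == 0).
Proof.
apply/idP/eqP => [/eqP x0|->].
  apply/rowP => i; rewrite mxE; apply/eqP; rewrite -normr_le0 -x0.
  exact: coord_le_enorm.
by rewrite -(scale0r (0 : 'rV[R]_n)) enormZ normr0 mul0r.
Qed.

(** Expanding (|y| x_i - |x| y_i)^2 >= 0 and dividing by 2 |x| |y| bounds each term; these bounds
    add up to |x| |y|. *)
Lemma cauchy_schwarz x y : \sum_(i < n) x 0 i * y 0 i <= enorm x * enorm y.
Proof.
have [->|x0] := eqVneq x 0.
  rewrite big1 ?mulr_ge0 ?enorm_ge0// => i _; by rewrite mxE mul0r.
have [->|y0] := eqVneq y 0.
  rewrite big1 ?mulr_ge0 ?enorm_ge0// => i _; by rewrite mxE mulr0.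
have xp : 0 < enorm x by rewrite lt_neqAle eq_sym enorm_eq0 x0 enorm_ge0.
have yp : 0 < enorm y by rewrite lt_neqAle eq_sym enorm_eq0 y0 enorm_ge0.
have H i : x 0 i * y 0 i <=
    (2^-1 * enorm y / enorm x) * x 0 i ^+ 2 + (2^-1 * enorm x / enorm y) * y 0 i ^+ 2.
  have := sqr_ge0 (enorm y * x 0 i - enorm x * y 0 i).
  move: (x 0 i) (y 0 i) (enorm x) (enorm y) xp yp => a b X Y X0 Y0 H.
  rewrite -subr_ge0 [leRHS](_ : _ = (Y * a - X * b) ^+ 2 / (2 * X * Y)).
    by rewrite divr_ge0// ?mulr_ge0// ltW.
  by field; rewrite !gt_eqF.
apply: le_trans (ler_sum _ (fun i _ => H i)) _.
rewrite big_split/= -!mulr_sumr -!sqr_enorm le_eqVlt; apply/orP; left; apply/eqP.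
by field; rewrite !gt_eqF.
Qed.

Lemma enormD x y : enorm (x + y) <= enorm x + enorm y.
Proof.
rewrite -(@ler_pXn2r _ 2) ?nnegrE ?addr_ge0 ?enorm_ge0// sqr_enorm.
under eq_bigr do rewrite mxE sqrrD.
rewrite !big_split/= -mulr2n -!sqr_enorm sqrrD lerD2r lerD2l ler_wMn2r//.
exact: cauchy_schwarz.
Qed.

Lemma measurable_enorm : measurable_fun setT (@enorm R n).
Proof.
apply: (measurableT_comp (continuous_measurable_fun (@sqrt_continuous R))) => //.
by apply: measurable_sum => i; apply: measurable_funX; exact: measurable_rV_coord.
Qed.

End enorm.

(** * Volume of balls *)

Section lebesgue_rV_theory.
Context {R : realType} {n : nat}.
Implicit Types (A B : set 'rV[R]_n) (x y : 'rV[R]_n).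

Lemma borel_lebesgue_measurable A : measurable A -> lebesgue_measurable A.
Proof.
by move=> mA; apply: sub_caratheodory; exact: sub_sigma_algebra.
Qed.

Lemma vol_borel A : measurable A -> vol A = borel_lebesgue_rV R n A.
Proof. exact: measurable_mu_extE. Qed.

Lemma lebesgue_rV_sigma_finite : sigma_finite setT (lebesgue_rV R n).
Proof.
apply: completed_measure_extension_sigma_finite; exact: sigma_finiteT.
Qed.

HB.instance Definition _ := @Measure_isSigmaFinite.Build _ _ _ (lebesgue_rV R n)
  lebesgue_rV_sigma_finite.

Lemma measurable_fun_completed d (Y : measurableType d) (f : 'rV[R]_n -> Y) :
  measurable_fun setT f ->
  measurable_fun setT (f : caratheodory_type ((borel_lebesgue_rV R n)^*)%mu -> Y).
Proof.
by move=> mf _ B mB; apply: borel_lebesgue_measurable; exact: mf.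
Qed.

Lemma measurable_eball x r : measurable (eball x r).
Proof.
rewrite (_ : eball x r = (fun y => enorm (- x + 1 *: y)) @^-1` `]-oo, r[%classic).
  rewrite -[X in measurable X]setTI.
  apply: (measurableT_comp measurable_enorm (measurable_affine_rV (- x) 1)) => //.
by apply/seteqP; split => y; rewrite /eball /= in_itv/= scale1r addrC.
Qed.

Lemma lebesgue_measurable_eball x r : lebesgue_measurable (eball x r).
Proof. by apply: borel_lebesgue_measurable; exact: measurable_eball. Qed.

Lemma vol_eball x r : 0 < r -> vol (eball x r) = @ball_vol R n r.
Proof.
move=> r0; rewrite /ball_vol !vol_borel; [|exact: measurable_eball..].
rewrite -(@borel_lebesgue_rV_affine _ _ x r)//; last exact: measurable_eball.
rewrite muleC; suff -> : (fun y => x + r *: y) @^-1` eball x r = eball 0 1 by [].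
apply/funext => y; rewrite /eball /preimage /mkset addrC addKr subr0 enormZ.
by rewrite gtr0_norm// -ltr_pdivlMl// mulVf// gt_eqF.
Qed.

(** The ball contains the cube of half-side 1/(n+1): each of the n squared coordinates is at most
    1/(n+1), so their sum is less than 1. *)
Lemma vol_eball1_gt0 : (0 < vol (eball (0 : 'rV[R]_n) 1))%E.
Proof.
have h0 : 0 < n.+1%:R^-1 :> R by rewrite invr_gt0.
have [mC vC] := @borel_lebesgue_rV_cube R n _ h0.
apply: (@lt_le_trans _ _ (vol [set x : 'rV[R]_n | forall i, `|x 0 i| < n.+1%:R^-1])).
  by rewrite vol_borel// vC lte_fin exprn_gt0// mulrn_wgt0.
apply: le_measure; rewrite ?inE.
- exact: borel_lebesgue_measurable.
- exact: lebesgue_measurable_eball.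
move=> x /= xh; rewrite /eball/= subr0.
rewrite -(@ltr_pXn2r _ 2) ?nnegrE ?enorm_ge0// sqr_enorm expr1n.
apply: (@le_lt_trans _ _ (\sum_(i < n) n.+1%:R^-1)).
  apply: ler_sum => i _; rewrite -real_normK ?num_real// expr2.
  rewrite -[leRHS]mulr1 ler_pM// ltW//.
  by rewrite (lt_le_trans (xh i))// invf_le1// ler1n.
by rewrite sumr_const card_ord -[_ *+ n]mulr_natr ltr_pdivrMl// mulr1 ltr_nat.
Qed.

Lemma vol_eball1_lty : (vol (eball (0 : 'rV[R]_n) 1) < +oo)%E.
Proof.
have [mC vC] := @borel_lebesgue_rV_cube R n _ ltr01.
apply: (@le_lt_trans _ _ (vol [set x : 'rV[R]_n | forall i, `|x 0 i| < 1])).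
  apply: le_measure; rewrite ?inE.
  - exact: lebesgue_measurable_eball.
  - exact: borel_lebesgue_measurable.
  move=> x; rewrite /eball/= subr0 => x1 i.
  exact: le_lt_trans (coord_le_enorm _ _) x1.
by rewrite vol_borel// vC ltry.
Qed.

Definition unit_ball_vol : R := fine (vol (eball (0 : 'rV[R]_n) 1)).

Lemma unit_ball_vol_gt0 : 0 < unit_ball_vol.
Proof. by rewrite fine_gt0// vol_eball1_gt0 vol_eball1_lty. Qed.

Lemma ball_volE r : @ball_vol R n r = (unit_ball_vol * r ^+ n)%:E.
Proof.
rewrite /ball_vol EFinM fineK// ge0_fin_numE ?vol_eball1_lty//.
Qed.

(** The sigma-algebra is generated by the coordinates, so an open set is exhibited as the countable
    union of the cubes [Q p], with rational centre and half-side 1/(k+1), that it contains. *)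
Lemma open_measurable_rV A : open A -> measurable A.
Proof.
move=> oA.
pose Q (p : 'rV[rat]_n * nat) : set 'rV[R]_n :=
  [set y | forall i, `|ratr (p.1 0 i) - y 0 i| < p.2.+1%:R^-1].
pose F p := if `[< Q p `<=` A >] then Q p else set0.
have -> : A = \bigcup_p F p.
  apply/seteqP; split => [x Ax|x [p _]]; last first.
    by rewrite /F; case: asboolP => // QA; exact: QA.
  have /nbhs_ballP[e /= e0 eA] := open_nbhs_nbhs (conj oA Ax).
  (* Two displacements below [e / 2], from [x] to the rational centre and from there to a point of
     the cube, stay below [e] together. *)
  have [k k0] : exists k : nat, k.+1%:R^-1 < e / 2.
    exists (Num.truncn (e / 2)^-1); rewrite -[ltRHS]invrK.
    rewrite ltf_pV2 ?posrE// ?invr_gt0 ?divr_gt0//.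
    exact: truncnS_gt.
  have H i : exists q : rat, `|ratr q - x 0 i| < k.+1%:R^-1.
    have [|q] := @rat_in_itvoo R (x 0 i) (x 0 i + k.+1%:R^-1).
      by rewrite ltrDl.
    rewrite in_itv/= => /andP[xq qx]; exists q; rewrite gtr0_norm ?subr_gt0//.
    by rewrite ltrBlDl.
  have {H}[q qP] := choice H.
  exists (\row_i q i, k) => //; rewrite /F; case: asboolP.
    by move=> _ i /=; rewrite mxE.
  case => y yQ; apply: eA; split => // i j; rewrite (ord1 i).
  have := yQ j; have := qP j; rewrite /ball/= mxE => q1 q2.
  rewrite (_ : x 0 j - y 0 j = (x 0 j - ratr (q j)) + (ratr (q j) - y 0 j)); last first.
    by ring.
  apply: le_lt_trans (ler_normD _ _) _; rewrite (distrC (x 0 j)).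
  by rewrite (splitr e) ltrD// (lt_trans _ k0)//.
apply: countable_bigcupT_measurable => // p; rewrite /F; case: ifP => // _.
rewrite (_ : Q p = \bigcap_(i in [set: 'I_n])
  (@rV_coord R n i @^-1` ball (ratr (p.1 0 i) : R) p.2.+1%:R^-1)).
  apply: fin_bigcap_measurable => // i _; rewrite -[X in measurable X]setTI.
  by apply: measurable_rV_coord => //; exact: measurable_ball.
by apply/seteqP; split => y /= yQ i; have := yQ i; [|move=> /(_ I)].
Qed.

End lebesgue_rV_theory.

(** * Integration *)

Section tonelli_on_sets.
Context d1 d2 (T1 : measurableType d1) (T2 : measurableType d2) (R : realType).
Variables (m1 : {sigma_finite_measure set T1 -> \bar R})
  (m2 : {sigma_finite_measure set T2 -> \bar R}).
Variables (A : set T1) (B : set T2) (f : T1 * T2 -> \bar R).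
Hypotheses (mA : measurable A) (mB : measurable B).
Hypotheses (mf : measurable_fun setT f) (f0 : forall p, (0 <= f p)%E).

Lemma measurable_integral_section :
  measurable_fun setT (fun x => \int[m2]_(y in B) f (x, y))%E.
Proof.
have mfB : measurable_fun setT (f \_ (setT `*` B)).
  apply/(measurable_restrictT _ _).1; first exact: measurableX.
  exact: measurable_funTS mf.
have fB0 p : (0 <= (f \_ (setT `*` B)) p)%E by exact: erestrict_ge0.
have := @measurable_fun_fubini_tonelli_F _ _ T1 T2 R m2 _ mfB fB0.
congr measurable_fun; apply/funext => x; rewrite /fubini_F [RHS]integral_mkcond.
by apply: eq_integral => y _; rewrite !patchE in_setX mem_set.
Qed.

(** Extending the integrand by zero outside the rectangle reduces this to Tonelli's theorem on the
    whole product. *)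
Lemma tonelli_on_sets :
  (\int[m1]_(x in A) \int[m2]_(y in B) f (x, y) =
   \int[m2]_(y in B) \int[m1]_(x in A) f (x, y))%E.
Proof.
pose g := f \_ (A `*` B).
have mg : measurable_fun setT g.
  apply/(measurable_restrictT _ _).1; first exact: measurableX.
  exact: measurable_funTS mf.
have g0 p : (0 <= g p)%E by exact: erestrict_ge0.
have := @fubini_tonelli _ _ T1 T2 R m1 m2 _ mg g0; rewrite /fubini_F /fubini_G => gC.
rewrite [LHS]integral_mkcond [RHS]integral_mkcond.
transitivity (\int[m1]_x \int[m2]_y g (x, y))%E; last rewrite gC.
- apply: eq_integral => x _; rewrite /g patchE; case: ifPn => xA.
    rewrite integral_mkcond; apply: eq_integral => y _.
    by rewrite !patchE in_setX /= xA.
  by rewrite integral0_eq// => y _; rewrite patchE in_setX /= (negbTE xA).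
- apply: eq_integral => y _; rewrite /g patchE; case: ifPn => yB.
    rewrite [RHS]integral_mkcond; apply: eq_integral => x _.
    by rewrite !patchE in_setX /= yB andbT.
  rewrite integral0_eq// => x _.
  by rewrite patchE in_setX /= (negbTE yB) andbF.
Qed.

End tonelli_on_sets.

(** The function is dominated by the series of [c j] times the indicator of [A j]; overlaps are
    harmless for an upper bound. Both singular integrals below, the tail of the kernel and the
    average over radii, are cut into dyadic pieces and summed in this way. *)
Lemma integral_le_geometric d (T : measurableType d) (R : realType)
    (mu : {measure set T -> \bar R}) (D : set T) (f : T -> \bar R)
    (A : nat -> set T) (c : nat -> R) (M q : R) :
  measurable D -> measurable_fun D f -> (forall x, D x -> (0 <= f x)%E) ->
  (forall j, measurable (A j)) -> (forall j, 0 <= c j) -> 0 <= M ->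
  0 <= q -> q < 1 ->
  (forall j, ((c j)%:E * mu (A j) <= (M * q ^+ j)%:E)%E) ->
  (forall x, D x -> (0 < f x)%E -> exists2 j, A j x & (f x <= (c j)%:E)%E) ->
  (\int[mu]_(x in D) f x <= (M / (1 - q))%:E)%E.
Proof.
move=> mD mf f0 mA c0 M0 q0 q1 cA cover.
pose g j x : \bar R := ((c j)%:E * (\1_(A j) x)%:E)%E.
have g0 j x : (0 <= g j x)%E by rewrite mule_ge0// lee_fin.
have mg j : measurable_fun D (g j).
  by apply: measurable_funeM; apply/measurable_EFinP; exact: measurable_indic.
apply: (@le_trans _ _ (\int[mu]_(x in D) \sum_(j <oo) g j x)%E).
  apply: ge0_le_integral => //.
  - exact: ge0_emeasurable_sum.
  - move=> x Dx; have [fx0|] := ltP 0%E (f x); last first.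
      by move=> fx0; apply: le_trans fx0 _; by apply: nneseries_ge0.
    have [j Ajx fcj] := cover x Dx fx0; apply: le_trans fcj _.
    rewrite (@nneseriesD1 _ _ j)//=.
    rewrite {1}/g indicE mem_set// mule1 leeDl//.
    by apply: nneseries_ge0.
rewrite integral_nneseries//.
apply: lime_le; first by apply: is_cvg_nneseries => j _ _; exact: integral_ge0.
apply: nearW => N.
apply: (@le_trans _ _ (\sum_(0 <= j < N) (M * q ^+ j)%:E)%E).
  apply: lee_sum => j _; apply: le_trans (cA j).
  rewrite ge0_integralZl_EFin//; last first.
    by apply/measurable_EFinP; exact: measurable_indic.
  rewrite integral_indic// lee_wpmul2l ?lee_fin//.
  by apply: le_measure; rewrite ?inE//; exact: measurableI.
rewrite sumEFin lee_fin.
have -> : \sum_(0 <= j < N) M * q ^+ j = M * (1 - q ^+ N) / (1 - q).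
  by have /(congr1 (@^~ N)) := @geometric_seriesE R M q (negbT (lt_eqF q1)).
rewrite ler_wpM2r ?invr_ge0 ?subr_ge0 ?(ltW q1)//.
by rewrite -[leRHS]mulr1 ler_wpM2l// gerBl exprn_ge0.
Qed.

(** * Interactions and minimizers *)

Section interaction_theory.
Context {R : realType} {n : nat} (s : R).
Implicit Types (A B E F Omega : set 'rV[R]_n) (x y : 'rV[R]_n).
Local Notation lebT := (caratheodory_type ((borel_lebesgue_rV R n)^*)%mu).
Local Notation mu := (lebesgue_rV R n).

Lemma measurable_enormB d (X : measurableType d) (f g : X -> 'rV[R]_n) :
  measurable_fun setT f -> measurable_fun setT g ->
  measurable_fun setT (fun t => enorm (f t - g t)).
Proof.
move=> mf mg; apply: (measurableT_comp measurable_enorm).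
apply: measurable_fun_rV => i.
rewrite (_ : _ \o _ = fun t => rV_coord i (f t) - rV_coord i (g t)); last first.
  by apply/funext => t; rewrite /= /rV_coord !mxE.
by apply: (@measurable_funB _ _ R); apply: measurableT_comp => //;
  exact: measurable_rV_coord.
Qed.

Lemma frac_kernelC x y : frac_kernel s x y = frac_kernel s y x.
Proof. by rewrite /frac_kernel -opprB enormN. Qed.

Lemma frac_kernel_ge0 x y : (0 <= frac_kernel s x y)%E.
Proof. by rewrite lee_fin invr_ge0 powR_ge0. Qed.

Lemma measurable_frac_kernel :
  measurable_fun setT (fun p : lebT * lebT => frac_kernel s p.1 p.2).
Proof.
apply/measurable_EFinP; under eq_fun do rewrite -powRN.
apply: (measurableT_comp (measurable_powR _)) => //.
apply: measurable_enormB.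
  apply: (measurableT_comp (measurable_fun_completed (@measurable_id _ _ setT))).
  exact: measurable_fst.
apply: (measurableT_comp (measurable_fun_completed (@measurable_id _ _ setT))).
exact: measurable_snd.
Qed.

Lemma measurable_frac_kernelr x :
  measurable_fun setT (fun y : lebT => frac_kernel s x y).
Proof.
exact: (measurableT_comp measurable_frac_kernel (pair1_measurable (x : lebT))).
Qed.

Lemma interactionC A B : lebesgue_measurable A -> lebesgue_measurable B ->
  interaction s A B = interaction s B A.
Proof.
move=> mA mB; rewrite /interaction.
have -> := @tonelli_on_sets _ _ _ _ R mu mu A B _ mA mB measurable_frac_kernel
  (fun p => frac_kernel_ge0 p.1 p.2).
apply: eq_integral => y _; apply: eq_integral => x _; exact: frac_kernelC.
Qed.

Lemma measurable_potential B : lebesgue_measurable B ->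
  measurable_fun setT (fun x : lebT => \int[mu]_(y in B) frac_kernel s x y)%E.
Proof.
move=> mB.
exact: (@measurable_integral_section _ _ _ _ R mu B _ mB measurable_frac_kernel
  (fun p => frac_kernel_ge0 p.1 p.2)).
Qed.

Lemma interaction_ge0 A B : (0 <= interaction s A B)%E.
Proof.
by apply: integral_ge0 => x _; apply: integral_ge0 => y _; exact: frac_kernel_ge0.
Qed.

Lemma interactionUl A1 A2 B : lebesgue_measurable A1 -> lebesgue_measurable A2 ->
  lebesgue_measurable B -> [disjoint A1 & A2] ->
  interaction s (A1 `|` A2) B = (interaction s A1 B + interaction s A2 B)%E.
Proof.
move=> mA1 mA2 mB dA.
apply: (@ge0_integral_setU _ lebT R mu A1 A2 mA1 mA2
  (fun x => \int[mu]_(y in B) frac_kernel s x y)%E _ _ dA).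
  exact: measurable_funTS (measurable_potential mB).
by move=> x _; apply: integral_ge0 => y _; exact: frac_kernel_ge0.
Qed.

Lemma interactionUr A B1 B2 : lebesgue_measurable A -> lebesgue_measurable B1 ->
  lebesgue_measurable B2 -> [disjoint B1 & B2] ->
  interaction s A (B1 `|` B2) = (interaction s A B1 + interaction s A B2)%E.
Proof.
move=> mA mB1 mB2 dB.
rewrite !(interactionC mA)//; last exact: measurableU.
exact: interactionUl.
Qed.

(** With F = E \ A as competitor, additivity expands both perimeters. The terms without [A] are
    common to both and cancel; what is left is L(A, CE) on one side and L(A, E \ A) on the other. *)
Lemma s_minimal_subsolution E Omega : open Omega -> lebesgue_measurable E ->
  s_minimal s E Omega -> subsolution s E Omega.
Proof.
move=> /open_measurable_rV/borel_lebesgue_measurable mO mE [PE minE] A mA AEO.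
have mEO : lebesgue_measurable (E `&` Omega `\` A).
  by apply: measurableD => //; exact: measurableI.
have mEDO : lebesgue_measurable (E `\` Omega) by exact: measurableD.
have mCE : lebesgue_measurable (~` E) by exact: measurableC.
have mCEO : lebesgue_measurable (~` E `&` Omega) by exact: measurableI.
have EO : E `&` Omega = A `|` (E `&` Omega `\` A) by rewrite setDUK.
have mF : lebesgue_measurable (E `\` A) by exact: measurableD.
have FDO : (E `\` A) `\` Omega = E `\` Omega.
  apply/seteqP; split => [x [[? ?] ?]|x [Ex nO]]; split => //.
  by split => // /AEO[].
have := minE _ mF FDO; move: PE; rewrite /perimeter FDO.
have -> : (E `\` A) `&` Omega = E `&` Omega `\` A.
  by rewrite !setDE -!setIA; congr (_ `&` _); rewrite setIC.
have AE : A `<=` E by move=> x /AEO[].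
have AO : A `<=` Omega by move=> x /AEO[].
have -> : ~` (E `\` A) = ~` E `|` A by rewrite setDE setCI setCK.
rewrite setIUl [A `&` Omega](setIidl AO) [X in interaction s X (~` E)]EO.
have dEA : [disjoint ~` E & A].
  by rewrite disj_set2E; apply/eqP/seteqP; split => // x [nE /AE].
have dEOA : [disjoint (~` E `&` Omega) & A].
  by rewrite disj_set2E; apply/eqP/seteqP; split => // x [[nE _] /AE].
have dA (B : set 'rV[R]_n) : [disjoint A & B `\` A].
  by rewrite disj_set2E setDIK.
rewrite (interactionUl mA mEO mCE (dA _)) (interactionUr mEO mCE mA dEA).
rewrite (interactionUr mEDO mCEO mA dEOA).
have := interaction_ge0 A (~` E).
have := interaction_ge0 (E `&` Omega `\` A) (~` E).
have := interaction_ge0 (E `\` Omega) (~` E `&` Omega).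
(* The perimeter of the competitor contains this interaction in two pieces, inside and outside
   [Omega]. *)
have -> : interaction s A (E `\` A) =
    (interaction s (E `&` Omega `\` A) A + interaction s (E `\` Omega) A)%E.
  rewrite interactionC// -interactionUl//; last first.
    by rewrite disj_set2E; apply/eqP/seteqP; split => // x [[[_ ?] _] [_]].
  congr (interaction s _ _); apply/seteqP; split => x.
    move=> [Ex nA]; have [Ox|nO] := pselect (Omega x); [left|right]; split => //.
  by move=> [[[Ex _] nA]|[Ex nO]]; split => // /AO.
(* Finiteness of the perimeter of [E] forces its three terms to be real, which makes the
   cancellation legitimate; the two new terms of the competitor may still be infinite. *)
case: (interaction s A (~` E)) => [a||] //;
case: (interaction s (E `&` Omega `\` A) (~` E)) => [b||] //;
case: (interaction s (E `\` Omega) (~` E `&` Omega)) => [c||] //.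
have := interaction_ge0 (E `&` Omega `\` A) A.
have := interaction_ge0 (E `\` Omega) A.
case: (interaction s (E `&` Omega `\` A) A) => [d||] //;
case: (interaction s (E `\` Omega) A) => [e||] // _ _ _ _ _ _;
  rewrite /= ?leey// -!EFinD !lee_fin; lra.
Qed.

(** Cut along [Omega], each perimeter is the sum of the same three interactions, up to symmetry of
    the kernel: inside with inside, and the two mixed ones. *)
Lemma perimeterC E Omega : open Omega -> lebesgue_measurable E ->
  perimeter s (~` E) Omega = perimeter s E Omega.
Proof.
move=> /open_measurable_rV/borel_lebesgue_measurable mO mE.
have mCE : lebesgue_measurable (~` E) by exact: measurableC.
have mEO : lebesgue_measurable (E `&` Omega) by exact: measurableI.
have mCEO : lebesgue_measurable (~` E `&` Omega) by exact: measurableI.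
have mEDO : lebesgue_measurable (E `\` Omega) by exact: measurableD.
have mCEDO : lebesgue_measurable (~` E `\` Omega) by exact: measurableD.
have dO (B : set 'rV[R]_n) : [disjoint (B `&` Omega) & (B `\` Omega)].
  by rewrite disj_set2E; apply/eqP/seteqP; split => // x [[_ ?] []].
rewrite /perimeter setCK.
have := interactionUr mCEO mEO mEDO (dO E); rewrite setUIDK => HC.
have := interactionUr mEO mCEO mCEDO (dO (~` E)); rewrite setUIDK => HE.
rewrite HC HE.
rewrite (interactionC mCEO mEO) (interactionC mCEO mEDO) (interactionC mCEDO mEO).
exact: addeAC.
Qed.

Lemma s_minimalC E Omega : open Omega -> lebesgue_measurable E ->
  s_minimal s E Omega -> s_minimal s (~` E) Omega.
Proof.
move=> oO mE [PE minE]; split; first by rewrite perimeterC.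
move=> F mF FO; rewrite (perimeterC oO mE) -(perimeterC oO mF).
apply: minE; first exact: measurableC.
apply/seteqP; split => x [nE nO]; split => //.
  apply: contrapT => nEx; have : (~` E `\` Omega) x by [].
  by rewrite -FO => -[].
move=> Fx; have : (F `\` Omega) x by [].
by rewrite FO => -[].
Qed.

End interaction_theory.

(** * Potential estimates *)

(** Selects the dyadic piece that contains a given point. The exponent is read off the integer part
    of [w]; the integer part plus one is at most 2^(j+1), whence the strict upper bound for [w]
    itself. *)
Lemma dyadic_bracket (R : realType) (w : R) : 1 <= w ->
  exists j : nat, 2 ^+ j <= w < 2 ^+ j.+1.
Proof.
move=> w1; exists (trunc_log 2 (Num.truncn w)).
have w0 : 0 <= w by apply: le_trans w1.
have t0 : (0 < Num.truncn w)%N by rewrite truncn_gt0.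
have /andP[l u] := trunc_log_bounds (isT : 1 < 2)%N t0.
have /andP[lw uw] := truncn_itv w0.
rewrite -!natrX; apply/andP; split.
  by apply: le_trans lw; rewrite ler_nat.
by apply: lt_le_trans uw _; rewrite ler_nat.
Qed.

Lemma powR2N_lt1 (R : realType) (a : R) : 0 < a -> 2 `^ (- a) < 1.
Proof.
move=> a0; rewrite powRN invf_lt1 ?powR_gt0//.
have := @gt0_ltr_powR R a a0 1 2; rewrite powR1; apply; rewrite ?nnegrE//.
by rewrite ltr1n.
Qed.

Section tail.
Context {R : realType} {n : nat} (s : R).
Hypothesis s_gt0 : 0 < s.
Implicit Types (A B E F Omega : set 'rV[R]_n) (x y : 'rV[R]_n).
Local Notation lebT := (caratheodory_type ((borel_lebesgue_rV R n)^*)%mu).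
Local Notation mu := (lebesgue_rV R n).
Local Notation w := (@unit_ball_vol R n).

Definition tail_cst : R := w * 2 ^+ n / (1 - 2 `^ (- s)).

Lemma tail_cst_gt0 : 0 < tail_cst.
Proof.
by rewrite divr_gt0 ?subr_gt0 ?powR2N_lt1// mulr_gt0 ?exprn_gt0// unit_ball_vol_gt0.
Qed.

Lemma vol_eballE x r : 0 < r -> vol (eball x r) = (w * r ^+ n)%:E.
Proof. by move=> r0; rewrite vol_eball// ball_volE. Qed.

Lemma frac_kernel_le x y r : 0 < r -> r <= enorm (x - y) ->
  (frac_kernel s x y <= (r `^ (- (n%:R + s)))%:E)%E.
Proof.
move=> r0 rxy; rewrite lee_fin powRN lef_pV2 ?posrE ?powR_gt0 ?(lt_le_trans r0)//.
by rewrite ge0_ler_powR// ?nnegrE ?enorm_ge0 ?(ltW r0)// addr_ge0// ltW.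
Qed.

(** The diagonal has to be excluded, since the kernel takes the default value 0 there. *)
Lemma frac_kernel_ge x y r : x != y -> enorm (x - y) <= r ->
  ((r `^ (- (n%:R + s)))%:E <= frac_kernel s x y)%E.
Proof.
move=> xy xyr.
have xy0 : 0 < enorm (x - y).
  by rewrite lt_neqAle eq_sym enorm_eq0 subr_eq0 xy enorm_ge0.
rewrite lee_fin powRN lef_pV2 ?posrE ?powR_gt0 ?(lt_le_trans xy0)//.
rewrite ge0_ler_powR// ?nnegrE ?enorm_ge0 ?(le_trans _ xyr) ?enorm_ge0//.
by rewrite addr_ge0// ltW.
Qed.

Lemma powR_mul_expn (r : R) : 0 < r -> r `^ (- (n%:R + s)) * r ^+ n = r `^ (- s).
Proof.
move=> r0; rewrite -powR_mulrn ?(ltW r0)// -powRD; last by rewrite (gt_eqF r0) implybT.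
by congr powR; ring.
Qed.

(** On the shell 2^j t <= |y - x| < 2^(j+1) t the kernel is at most (2^j t)^-(n+s), and the
    enclosing ball has volume w (2^(j+1) t)^n. The product is w 2^n t^-s times 2^(-sj), and
    [tail_cst] is the sum of this series without t^-s. *)
Lemma potential_tail x t : 0 < t ->
  (\int[mu]_(y in ~` eball x t) frac_kernel s x y
    <= (tail_cst * t `^ (- s))%:E)%E.
Proof.
move=> t0.
rewrite [X in (_ <= X%:E)%E](_ : _ =
  (w * 2 ^+ n * t `^ (- s)) / (1 - 2 `^ (- s))); last first.
  by rewrite /tail_cst; ring.
apply: (@integral_le_geometric _ lebT R mu _ _
  (fun j => eball x (2 ^+ j.+1 * t)) (fun j => (2 ^+ j * t) `^ (- (n%:R + s)))).
- by apply: measurableC; exact: lebesgue_measurable_eball.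
- by apply: measurable_funTS; exact: measurable_frac_kernelr.
- by move=> y _; exact: frac_kernel_ge0.
- by move=> j; exact: lebesgue_measurable_eball.
- by move=> j; exact: powR_ge0.
- by rewrite !mulr_ge0 ?powR_ge0 ?exprn_ge0// ltW// unit_ball_vol_gt0.
- exact: powR_ge0.
- exact: powR2N_lt1.
- move=> j; have jt0 : 0 < 2 ^+ j * t by rewrite mulr_gt0// exprn_gt0.
  rewrite [X in (_ * X)%E]vol_eballE; last by rewrite mulr_gt0// exprn_gt0.
  have -> : 2 ^+ j.+1 * t = 2 * (2 ^+ j * t) by rewrite exprS mulrA.
  rewrite -EFinM lee_fin exprMn.
  rewrite [leLHS](_ : _ = w * 2 ^+ n *
    ((2 ^+ j * t) `^ (- (n%:R + s)) * (2 ^+ j * t) ^+ n)); last by ring.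
  rewrite powR_mul_expn// powRM ?exprn_ge0 ?(ltW t0)//.
  rewrite -(powR_mulrn j (ler0n _ 2)) -(powR_mulrn j (powR_ge0 _ _)) -!powRrM.
  by rewrite [X in 2 `^ X]mulrC le_eqVlt; apply/orP; left; apply/eqP; ring.
move=> y; rewrite /eball/= => /negP; rewrite -leNgt => txy _.
have [|j /andP[j1 j2]] := @dyadic_bracket R (enorm (y - x) / t).
  by rewrite ler_pdivlMr// mul1r.
exists j; first by rewrite /= -ltr_pdivrMr.
apply: frac_kernel_le; first by rewrite mulr_gt0// exprn_gt0.
by rewrite -enormN opprB -ler_pdivlMr.
Qed.

(** The set [A] fills at most half of the ball of radius [r] about [x], so at least half of the ball
    lies outside [A], and there the kernel is at least r^-(n+s). *)
Lemma potential_compl_ge A x r : lebesgue_measurable A -> A x -> 0 < r ->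
  (vol A <= (w / 2 * r ^+ n)%:E)%E ->
  ((w / 2 * r `^ (- s))%:E <= \int[mu]_(y in ~` A) frac_kernel s x y)%E.
Proof.
move=> mA Ax r0 vA.
have mB := @lebesgue_measurable_eball R n x r.
have mBA : lebesgue_measurable (eball x r `\` A) by exact: measurableD.
apply: (@le_trans _ _
  (\int[mu]_(y in eball x r `\` A) frac_kernel s x y)%E); last first.
  apply: (@ge0_subset_integral _ lebT R mu) => //.
  - exact: measurableC.
  - by apply: measurable_funTS; exact: measurable_frac_kernelr.
  - by move=> y _; exact: frac_kernel_ge0.
apply: (@le_trans _ _
  (\int[mu]_(y in eball x r `\` A) (r `^ (- (n%:R + s)))%:E)%E); last first.
  apply: (@ge0_le_integral _ lebT R mu) => //.
  - by move=> y _; rewrite lee_fin powR_ge0.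
  - by apply: measurable_funTS; exact: measurable_frac_kernelr.
  - move=> y [xyr nAy]; apply: frac_kernel_ge.
      (* The point [x] lies in [A] and [y] does not, which keeps [y] off the diagonal. *)
      by apply/eqP => xy; apply: nAy; rewrite -xy.
    by rewrite -enormN opprB ltW.
rewrite (@integral_cst _ lebT)//.
have vBA : ((w / 2 * r ^+ n)%:E <= vol (eball x r `\` A))%E.
  have H : (vol (A `|` (eball x r `\` A)) <= vol A + vol (eball x r `\` A))%E.
    exact: (@measureU2 _ lebT R mu A (eball x r `\` A) mA mBA).
  have : (vol (eball x r) <= vol A + vol (eball x r `\` A))%E.
    apply: le_trans H; apply: le_measure; rewrite ?inE//; first exact: measurableU.
    by move=> y By; have [Ay|nAy] := pselect (A y); [left|right; split].
  rewrite vol_eballE//; move: vA.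
  have : (0 <= vol A)%E by exact: measure_ge0.
  case: (vol A) => [a||]//; case: (vol (eball x r `\` A)) => [b||]//; rewrite ?leey//.
  by rewrite -EFinD !lee_fin; lra.
apply: le_trans (lee_wpmul2l _ vBA); last by rewrite lee_fin powR_ge0.
rewrite -EFinM lee_fin mulrCA powR_mul_expn//.
Qed.

End tail.

(** * Integrability in the radius of the singularity at the sphere *)

Lemma powRN_le (R : realType) (a x y : R) :
  0 <= a -> 0 < x -> x <= y -> y `^ (- a) <= x `^ (- a).
Proof.
move=> a0 x0 xy; have y0 := lt_le_trans x0 xy.
by rewrite !powRN lef_pV2 ?posrE ?powR_gt0// ge0_ler_powR// nnegrE ltW.
Qed.

Section radial.
Context {R : realType} (s : R).
Hypotheses (s_gt0 : 0 < s) (s_lt1 : s < 1).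

(** Up to [tail_cst], the bound of [potential_tail] for the complement of a ball
    of radius [rho], at a point at distance [m] from its centre. The test is
    needed because [powR] maps negative numbers to [1]. *)
Definition radial_weight (m rho : R) : \bar R :=
  (if m < rho then (rho - m) `^ (- s) else 0)%:E.

Lemma radial_weight_ge0 m rho : (0 <= radial_weight m rho)%E.
Proof. by rewrite lee_fin; case: ifP => // _; exact: powR_ge0. Qed.

Lemma measurable_radial_weight d (T : measurableType d) (f g : T -> R) :
  measurable_fun setT f -> measurable_fun setT g ->
  measurable_fun setT (fun t => radial_weight (f t) (g t)).
Proof.
move=> mf mg; apply/measurable_EFinP; apply: measurable_fun_ifT => //.
- exact: measurable_fun_ltr.
- by apply: (measurableT_comp (measurable_powR _)) => //; exact: measurable_funB.
Qed.

(** Sum of the geometric series of ratio 2^-(1-s) met in [integral_radial_weight]; the factor 2^s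
    comes from evaluating the weight at the short end of each dyadic interval. *)
Definition radial_cst : R := 2 `^ s / (1 - 2 `^ (- (1 - s))).

Lemma radial_cst_gt0 : 0 < radial_cst.
Proof. by rewrite divr_gt0 ?powR_gt0// subr_gt0 powR2N_lt1// subr_gt0. Qed.

(** Since s < 1, the dyadic pieces of (rho - m)^-s decay geometrically towards the singularity. The
    bound is uniform in [m], as needed once the order of integration is exchanged. *)
Lemma integral_radial_weight (a b m : R) : a < b ->
  (\int[lebesgue_measure]_(rho in `]a, b[%classic) radial_weight m rho
    <= (radial_cst * (b - a) `^ (1 - s))%:E)%E.
Proof.
move=> ab; have d0 : 0 < b - a by rewrite subr_gt0.
(* The weight vanishes for rho <= m, so only rho > c counts. There rho - m >= rho - c, and rho - c
   <= d because a <= c. *)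
set d := b - a in d0 *; set c := Order.max a m.
rewrite [X in (_ <= X%:E)%E](_ : _ =
  (2 `^ s * d `^ (1 - s)) / (1 - 2 `^ (- (1 - s)))); last first.
  by rewrite /radial_cst; ring.
have z0 j : 0 < d / 2 ^+ j by rewrite divr_gt0// exprn_gt0.
apply: (@integral_le_geometric _ (measurableTypeR R) R lebesgue_measure _ _
  (fun j => `]c, c + d / 2 ^+ j]%classic) (fun j => (d / 2 ^+ j.+1) `^ (- s))).
- exact: measurable_itv.
- by apply: measurable_funTS; exact: measurable_radial_weight.
- by move=> rho _; exact: radial_weight_ge0.
- by move=> j; exact: measurable_itv.
- by move=> j; exact: powR_ge0.
- by rewrite mulr_ge0 ?powR_ge0.
- exact: powR_ge0.
- by apply: powR2N_lt1; rewrite subr_gt0.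
- move=> j.
  rewrite [X in (_ * X)%E](_ : _ = (d / 2 ^+ j)%:E); last first.
    rewrite [LHS]lebesgue_measure_itv/= lte_fin ltrDl z0 -EFinB.
    by rewrite addrAC subrr add0r.
  rewrite -EFinM lee_fin.
  have -> : d / 2 ^+ j.+1 = d / 2 ^+ j * 2^-1 by rewrite exprSr invfM mulrA.
  rewrite powRM ?invr_ge0// ?(ltW (z0 j))//.
  rewrite -(powR_inv1 (ler0n R 2)) -powRrM mulrN mulN1r opprK.
  rewrite mulrAC -[X in _ * X * _](powRr1 (ltW (z0 j))) -powRD; last first.
    by rewrite (gt_eqF (z0 j)) implybT.
  rewrite addrC powRM ?invr_ge0 ?exprn_ge0 ?(ltW d0)//.
  rewrite -(powR_invn j (ler0n R 2)) -(powR_mulrn j (powR_ge0 _ _)) -!powRrM.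
  rewrite [X in _ * 2 `^ X * _ <= _](_ : _ = - (1 - s) * j%:R); last by ring.
  by rewrite le_eqVlt; apply/orP; left; apply/eqP; ring.
move=> rho; rewrite /= in_itv/= => /andP[arho rhob].
rewrite lte_fin; case: ifP => [mrho _|_]; last by rewrite ltxx.
have crho : c < rho by rewrite /c gt_max arho.
have rc0 : 0 < rho - c by rewrite subr_gt0.
have ac : a <= c by rewrite le_max lexx.
have mc : m <= c by rewrite le_max lexx orbT.
have [|j /andP[j1 j2]] := @dyadic_bracket R (d / (rho - c)).
  by rewrite ler_pdivlMr// mul1r lerB// ltW.
exists j.
  rewrite /= in_itv/= crho/= -lerBlDl ler_pdivlMr ?exprn_gt0// mulrC.
  by rewrite -ler_pdivlMr.
rewrite lee_fin mrho; apply: powRN_le; [exact: ltW|exact: z0|].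
apply: (@le_trans _ _ (rho - c)); last by rewrite lerB.
by rewrite ler_pdivrMr ?exprn_gt0// mulrC -ler_pdivrMr// ltW.
Qed.

End radial.

(** * Density of subsolutions *)

Section density.
Context {R : realType} {n : nat} (s : R).
Hypotheses (s_gt0 : 0 < s) (s_lt1 : s < 1).
Implicit Types (A B E F Omega : set 'rV[R]_n) (x y : 'rV[R]_n).
Local Notation lebT := (caratheodory_type ((borel_lebesgue_rV R n)^*)%mu).
Local Notation mu := (lebesgue_rV R n).
Local Notation w := (@unit_ball_vol R n).
Local Notation C1 := (@tail_cst R n s).
Local Notation C3 := (@radial_cst R s).

Lemma measurable_edist x : measurable_fun setT (fun y : lebT => enorm (y - x)).
Proof.
apply: (measurable_enormB (f := fun y : lebT => y : 'rV[R]_n) (g := fun=> x)).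
  exact: measurable_fun_completed (@measurable_id _ _ setT).
exact: measurable_cst.
Qed.

Lemma sub_eball x a b : a <= b -> eball x a `<=` eball x b.
Proof. by move=> ab y; rewrite /eball/= => /lt_le_trans; exact. Qed.

(** The potential of the complement of A splits into those of CE and of E \ A. Integrated over A,
    the first is at most the second by the subsolution property, which explains the factor 2; the
    second is controlled by [potential_tail]. *)
Lemma subsolution_eball E Omega x (rho r : R) : lebesgue_measurable E ->
  subsolution s E Omega -> eball x rho `<=` Omega -> 0 < r ->
  (vol (E `&` eball x rho) <= (w / 2 * r ^+ n)%:E)%E ->
  ((w / 2 * r `^ (- s))%:E * vol (E `&` eball x rho) <=
   (2 * C1)%:E * \int[mu]_(y in E `&` eball x rho)
     radial_weight s (enorm (y - x)) rho)%E.
Proof.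
move=> mE subE BO r0; set A := E `&` eball x rho => vA.
have mB := @lebesgue_measurable_eball R n x rho.
have mA : lebesgue_measurable A by exact: measurableI.
have mCE : lebesgue_measurable (~` E) by exact: measurableC.
have mEA : lebesgue_measurable (E `\` A) by exact: measurableD.
have AE : A `<=` E by move=> y [].
have k0 := @frac_kernel_ge0 R n s.
pose P B (y : lebT) : \bar R := (\int[mu]_(z in B) frac_kernel s y z)%E.
have P0 B y : (0 <= P B y)%E by apply: integral_ge0 => z _; exact: k0.
have mP B : lebesgue_measurable B -> measurable_fun (A : set lebT) (P B).
  by move=> mB'; apply: measurable_funTS; exact: (measurable_potential s mB').
have PD y : P (~` A) y = (P (~` E) y + P (E `\` A) y)%E.
  have -> : ~` A = ~` E `|` E `\` A.
    apply/seteqP; split => z.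
      by move=> nAz; have [Ez|nEz] := pselect (E z); [right|left].
    by move=> [nEz /AE //|[]].
  apply: (@ge0_integral_setU _ lebT R mu _ _ mCE mEA (frac_kernel s y)) => //.
    by apply: measurable_funTS; exact: measurable_frac_kernelr.
  by rewrite disj_set2E; apply/eqP/seteqP; split => // z [? []].
apply: (@le_trans _ _ (\int[mu]_(y in A) (w / 2 * r `^ (- s))%:E)%E).
  by rewrite (@integral_cst _ lebT R mu).
apply: (@le_trans _ _ (\int[mu]_(y in A) (P (~` E) y + P (E `\` A) y))%E).
  apply: (@ge0_le_integral _ lebT R mu A mA).
  - move=> y _; rewrite lee_fin !mulr_ge0 ?powR_ge0 ?invr_ge0//.
    exact: ltW unit_ball_vol_gt0.
  - exact: measurable_cst.
  - exact: emeasurable_funD (mP _ mCE) (mP _ mEA).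
  - by move=> y Ay; rewrite -PD; exact: potential_compl_ge.
rewrite (@ge0_integralD _ lebT R mu A mA (P (~` E)) (P (E `\` A)) (fun y _ => P0 _ y)
  (mP _ mCE) (fun y _ => P0 _ y) (mP _ mEA)).
apply: (@le_trans _ _
  (\int[mu]_(y in A) P (E `\` A) y + \int[mu]_(y in A) P (E `\` A) y)%E).
  by apply: leeD2r; apply: subE => // y [Ey /BO].
have mW : measurable_fun setT (fun y : lebT => radial_weight s (enorm (y - x)) rho).
  exact: (measurable_radial_weight s (measurable_edist x) (measurable_cst _)).
have H : (\int[mu]_(y in A) P (E `\` A) y <=
    C1%:E * \int[mu]_(y in A) radial_weight s (enorm (y - x)) rho)%E.
  have mWA := @measurable_funTS _ _ lebT _ A _ mW.
  rewrite -(@ge0_integralZl_EFin _ lebT R mu A mA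
    (fun y => radial_weight s (enorm (y - x)) rho)
    (fun y _ => radial_weight_ge0 s _ _) mWA C1 (ltW (@tail_cst_gt0 R n s s_gt0))).
  apply: (@ge0_le_integral _ lebT R mu A mA _ _ (fun y _ => P0 _ y) (mP _ mEA)).
    exact: measurable_funeM.
  move=> y [Ey yrho]; have yr : enorm (y - x) < rho by [].
  have t0 : 0 < rho - enorm (y - x) by rewrite subr_gt0.
  rewrite /radial_weight yr -EFinM.
  apply: le_trans (potential_tail s_gt0 y t0).
  apply: (@ge0_subset_integral _ lebT R mu (E `\` A) _ mEA
    (measurableC (@lebesgue_measurable_eball R n y _)) (frac_kernel s y)
    (measurable_funTS (measurable_frac_kernelr s y)) (fun z _ => k0 y z)).
  (* By the triangle inequality the ball of radius rho - |y - x| about [y] lies in the ball of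
     radius [rho] about [x], which E \ A avoids. *)
  move=> z [Ez nAz] /= zy; apply: nAz; split => //; rewrite /eball/=.
  rewrite (_ : z - x = (z - y) + (y - x)); last by rewrite addrA subrK.
  by apply: le_lt_trans (enormD _ _) _; rewrite -ltrBrDr.
apply: le_trans (leeD H H) _.
by rewrite -ge0_muleDl ?lee_fin ?(ltW (tail_cst_gt0 s_gt0))// -EFinD mulr_natl mulr2n.
Qed.

(** For a given radius [rho] the right-hand side of [subsolution_eball] may be
    infinite, hence the average over [rho] in ]a, b[. *)
Lemma density_step E Omega x (a b r : R) : lebesgue_measurable E ->
  subsolution s E Omega -> eball x b `<=` Omega -> a < b -> 0 < r ->
  (vol (E `&` eball x b) <= (w / 2 * r ^+ n)%:E)%E ->
  ((b - a)%:E * ((w / 2 * r `^ (- s))%:E * vol (E `&` eball x a)) <=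
   (2 * C1 * C3 * (b - a) `^ (1 - s))%:E * vol (E `&` eball x b))%E.
Proof.
move=> mE subE BO ab r0 vb.
have mEB t : lebesgue_measurable (E `&` eball x t).
  by apply: measurableI => //; exact: lebesgue_measurable_eball.
have vol_mono t u : t <= u -> (vol (E `&` eball x t) <= vol (E `&` eball x u))%E.
  move=> tu; have mt := mEB t; have mu1 := mEB u; apply: le_measure; rewrite ?inE//.
  by move=> y [Ey yt]; split => //; exact: sub_eball yt.
set kappa := w / 2 * r `^ (- s).
have kappa0 : 0 <= kappa.
  by rewrite !mulr_ge0 ?powR_ge0 ?invr_ge0// ltW// unit_ball_vol_gt0.
have C10 : 0 <= 2 * C1 by rewrite mulr_ge0// ltW// tail_cst_gt0.
pose W (p : measurableTypeR R * lebT) := radial_weight s (enorm (p.2 - x)) p.1.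
have mW : measurable_fun setT W.
  apply: measurable_radial_weight; last exact: measurable_fst.
  by apply: (measurableT_comp (measurable_edist x)); exact: measurable_snd.
have W0 p : (0 <= W p)%E by exact: radial_weight_ge0.
pose I : set (measurableTypeR R) := `]a, b[%classic.
have mI : measurable I by exact: measurable_itv.
have lI : lebesgue_measure I = (b - a)%:E.
  by rewrite [LHS]lebesgue_measure_itv/= lte_fin ab.
have mJ : measurable_fun setT (fun rho => \int[mu]_(y in E `&` eball x b) W (rho, y))%E.
  exact: (@measurable_integral_section _ _ (measurableTypeR R) lebT R mu _ _
    (mEB b) mW W0).
apply: (@le_trans _ _
  (\int[lebesgue_measure]_(rho in I) (kappa%:E * vol (E `&` eball x a)))%E).
  have : (vol (E `&` eball x a) <= (w / 2 * r ^+ n)%:E)%E.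
    by apply: le_trans vb; apply: vol_mono; exact: ltW.
  have : (0 <= vol (E `&` eball x a))%E by exact: measure_ge0.
  case: (vol (E `&` eball x a)) => [v||]// v0 _.
  rewrite -EFinM [leRHS](_ : _ = (kappa * v)%:E * (b - a)%:E)%E; first by rewrite muleC.
  by rewrite -lI; exact: (@integral_cst _ (measurableTypeR R) R lebesgue_measure).
(* For [rho] in ]a, b[ the domain of the inner integral is enlarged from radius [rho] to radius [b],
   so that Tonelli's theorem applies on a rectangle. *)
apply: (@le_trans _ _ (\int[lebesgue_measure]_(rho in I)
    ((2 * C1)%:E * \int[mu]_(y in E `&` eball x b) W (rho, y)))%E).
  have ka0 rho : I rho -> (0 <= kappa%:E * vol (E `&` eball x a))%E.
    by move=> _; rewrite mule_ge0// lee_fin.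
  apply: (@ge0_le_integral _ (measurableTypeR R) R lebesgue_measure I mI _ _ ka0
    (measurable_cst _) (measurable_funeM _ (measurable_funTS mJ))).
  move=> rho; rewrite /I/= in_itv/= => /andP[arho rhob].
  apply: (@le_trans _ _ (kappa%:E * vol (E `&` eball x rho))%E).
    by rewrite lee_wpmul2l ?lee_fin//; apply: vol_mono; exact: ltW.
  apply: (@le_trans _ _
    ((2 * C1)%:E * \int[mu]_(y in E `&` eball x rho) W (rho, y))%E).
    apply: (subsolution_eball mE subE) => //.
      by apply: subset_trans BO; apply: sub_eball; exact: ltW.
    by apply: le_trans vb; apply: vol_mono; exact: ltW.
  rewrite lee_wpmul2l ?lee_fin//.
  have mWr : measurable_fun setT (fun y : lebT => W (rho, y)).
    exact: (measurable_radial_weight s (measurable_edist x) (measurable_cst rho)).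
  apply: (@ge0_subset_integral _ lebT R mu _ _ (mEB rho) (mEB b) _
    (measurable_funTS mWr) (fun y _ => W0 (rho, y))).
  by move=> y [Ey yr]; split => //; exact: sub_eball (ltW rhob) _ yr.
have J0 rho : I rho -> (0 <= \int[mu]_(y in E `&` eball x b) W (rho, y))%E.
  by move=> _; apply: integral_ge0 => y _.
rewrite (@ge0_integralZl_EFin _ (measurableTypeR R) R lebesgue_measure I mI _ J0
  (measurable_funTS mJ) _ C10).
rewrite (@tonelli_on_sets _ _ (measurableTypeR R) lebT R lebesgue_measure mu _ _ W
  mI (mEB b) mW W0).
rewrite -[2 * C1 * C3 * _]mulrA [X in (_ <= X * _)%E]EFinM -muleA.
rewrite lee_wpmul2l ?lee_fin//.
rewrite -(@integral_cst _ lebT R mu _ (mEB b)).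
(* The variables are swapped because [measurable_integral_section] integrates out the second one. *)
pose W' (p : lebT * measurableTypeR R) := W (p.2, p.1).
have mW' : measurable_fun setT W'.
  apply: measurable_radial_weight; last exact: measurable_snd.
  by apply: (measurableT_comp (measurable_edist x)); exact: measurable_fst.
have mV := @measurable_integral_section _ _ lebT (measurableTypeR R) R
  lebesgue_measure I W' mI mW' (fun p => W0 _).
have V0 (y : lebT) : (E `&` eball x b) y ->
    (0 <= \int[lebesgue_measure]_(rho in I) W (rho, y))%E.
  by move=> _; apply: integral_ge0 => rho _.
have V1 (y : lebT) : (\int[lebesgue_measure]_(rho in I) W (rho, y) <=
    (C3 * (b - a) `^ (1 - s))%:E)%E.
  exact: (@integral_radial_weight R s s_gt0 s_lt1 a b (enorm (y - x)) ab).
exact: (@ge0_le_integral _ lebT R mu _ (mEB b) _ _ V0 (measurable_funTS mV)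
  (measurable_cst (C3 * (b - a) `^ (1 - s))%:E) (fun y _ => V1 y)).
Qed.

End density.

(** * Iteration on shrinking balls *)

Section density_estimate.
Context {R : realType} {n : nat} (s : R).
Hypotheses (n_gt0 : (0 < n)%N) (s_gt0 : 0 < s) (s_lt1 : s < 1).
Implicit Types (E Omega : set 'rV[R]_n) (x : 'rV[R]_n).
Local Notation w := (@unit_ball_vol R n).

(** Dividing [density_step] by (b - a) (w / 2) r^-s turns it into |E meet B_a| <= C2 (r / (b - a))^s
    |E meet B_b|. *)
Let C2 : R := 2 * (2 * @tail_cst R n s * @radial_cst R s) / w.

Let C2_gt0 : 0 < C2.
Proof.
rewrite divr_gt0 ?unit_ball_vol_gt0// mulr_gt0//.
by rewrite mulr_gt0 ?(radial_cst_gt0 s_lt1)// mulr_gt0// (tail_cst_gt0 s_gt0).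
Qed.

(** Solves [C2 * (4 * eps) `^ s = 2 ^- n]. *)
Definition density_radius : R := (2 ^+ n * C2) `^ (- s^-1) / 4.
Local Notation eps := density_radius.

Lemma density_radius_gt0 : 0 < eps.
Proof. by rewrite divr_gt0// powR_gt0// mulr_gt0// exprn_gt0. Qed.

Let density_radiusE : C2 * (4 * eps) `^ s = 2^-1 ^+ n.
Proof.
have X0 : 0 < 2 ^+ n * C2 by rewrite mulr_gt0// exprn_gt0.
rewrite /eps mulrCA divff// mulr1 -powRrM mulNr mulVf ?gt_eqF// powR_inv1 ?ltW//.
by rewrite invfM exprVn mulrCA divff ?gt_eqF// mulr1.
Qed.

Let vol_fin E x t : lebesgue_measurable E -> 0 < t ->
  exists2 u, 0 <= u & vol (E `&` eball x t) = u%:E.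
Proof.
move=> mE t0; have mB := @lebesgue_measurable_eball R n x t.
have : (vol (E `&` eball x t) <= (w * t ^+ n)%:E)%E.
  rewrite -(vol_eballE x t0); apply: le_measure; rewrite ?inE//.
  exact: measurableI.
have : (0 <= vol (E `&` eball x t))%E by exact: measure_ge0.
by case: (vol _) => [u||]// u0 _; exists u.
Qed.

(** The bound at step k is exactly the smallness that [density_step] requires at scale eps r 2^-k,
    so the induction hypothesis serves both as its premise and as the estimate to be improved. *)
Lemma density_decay E Omega x (r : R) : lebesgue_measurable E ->
  subsolution s E Omega -> eball x r `<=` Omega -> 0 < r ->
  (vol (E `&` eball x r) <= (w / 2 * (eps * r) ^+ n)%:E)%E ->
  forall k, (vol (E `&` eball x (r / 2 * (1 + 2^-1 ^+ k))) <=
             (w / 2 * (eps * r * 2^-1 ^+ k) ^+ n)%:E)%E.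
Proof.
move=> mE subE BO r0 v0; elim=> [|k IH].
  by rewrite expr0 mulr1 (_ : r / 2 * (1 + 1) = r)//; field.
set q := 2^-1 ^+ k in IH *; have q0 : 0 < q by rewrite exprn_gt0.
have q1 : q <= 1 by rewrite exprn_ile1// invf_le1// ler1n.
have e0 := density_radius_gt0.
have w0 := @unit_ball_vol_gt0 R n.
set b := r / 2 * (1 + q) in IH *; set a := r / 2 * (1 + 2^-1 ^+ k.+1).
have aE : a = r / 2 * (1 + q / 2) by rewrite /a exprSr.
have ba : b - a = r * q / 4 by rewrite aE /b; field.
have ab : a < b by rewrite -subr_gt0 ba divr_gt0// mulr_gt0.
have a0 : 0 < a by rewrite aE mulr_gt0 ?divr_gt0// addr_gt0// divr_gt0.
have rk0 : 0 < eps * r * q by exact: mulr_gt0 (mulr_gt0 e0 r0) q0.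
have := density_step s_gt0 s_lt1 mE subE _ ab rk0 IH.
have [u u0 ->] := vol_fin x mE a0.
have [v v0' vE] := vol_fin x mE (lt_trans a0 ab); rewrite vE in IH *.
have br : b <= r.
  rewrite -[leRHS](_ : r / 2 * (1 + 1) = r); last by field.
  by rewrite ler_pM2l ?divr_gt0// lerD2l.
move=> /(_ (subset_trans (sub_eball br) BO)); rewrite -!EFinM lee_fin => H.
rewrite lee_fin in IH *; rewrite exprSr -/q.
have d0 : 0 < b - a by rewrite subr_gt0.
(* The quotient of the two scales does not depend on [k]. *)
have E1 : eps * r * q = 4 * eps * (b - a) by rewrite ba; field.
have e40 : 0 < 4 * eps by rewrite mulr_gt0.
have key : u <= C2 * (4 * eps) `^ s * v.
  move: H; rewrite E1 powRM ?(ltW d0) ?(ltW e40)// powRB ?(gt_eqF d0) ?implybT//.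
  rewrite powRr1 ?(ltW d0)// !powRN.
  set X := (4 * eps) `^ s; set Y := (b - a) `^ s.
  have X0 : 0 < X by exact: powR_gt0.
  have Y0 : 0 < Y by exact: powR_gt0.
  set C := 2 * _ * _; rewrite /C2 -/C => H.
  (* Multiplying the goal by this factor recovers the left-hand side of [H]. *)
  have Z0 : 0 < (b - a) * w / (2 * X * Y) by rewrite divr_gt0 ?mulr_gt0.
  rewrite -(ler_pM2l Z0).
  rewrite [leLHS](_ : _ = (b - a) * (w / 2 * (X^-1 * Y^-1) * u)).
    apply: le_trans H _; rewrite le_eqVlt; apply/orP; left; apply/eqP; field.
    by rewrite !gt_eqF.
  by field; rewrite !gt_eqF.
(* By the choice of [eps] the gain is 2^-n, the ratio of two consecutive bounds. *)
rewrite density_radiusE in key; apply: le_trans key _.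
rewrite mulrA [leRHS](_ : _ = 2^-1 ^+ n * (w / 2 * (eps * r * q) ^+ n)).
  by rewrite ler_pM2l// exprn_gt0.
by rewrite [in LHS]exprMn; ring.
Qed.

(** Makes [density_cst * r ^+ n] the smallness threshold of [density_decay]. *)
Definition density_cst : R := w / 2 * eps ^+ n.

Lemma density_cst_gt0 : 0 < density_cst.
Proof.
rewrite mulr_gt0 ?divr_gt0 ?unit_ball_vol_gt0// exprn_gt0//.
exact: density_radius_gt0.
Qed.

(** Below the threshold, [density_decay] applies at every step. All its balls contain the one of
    radius r / 2, whose share of [E] would then be at most M 2^-k for every k, hence zero. *)
Lemma density_estimate E Omega x (r : R) : lebesgue_measurable E ->
  subsolution s E Omega -> eball x r `<=` Omega -> 0 < r ->
  (0 < vol (E `&` eball x (r / 2)))%E ->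
  ((density_cst * r ^+ n)%:E <= vol (E `&` eball x r))%E.
Proof.
move=> mE subE BO r0 v0; rewrite leNgt; apply/negP => /ltW.
rewrite /density_cst -mulrA -exprMn => vr.
have H := density_decay mE subE BO r0 vr.
have r20 : 0 < r / 2 by rewrite divr_gt0.
have [u u0 uE] := vol_fin x mE r20; rewrite uE lte_fin in v0.
have M0 : 0 < w / 2 * (eps * r) ^+ n.
  rewrite mulr_gt0 ?divr_gt0 ?unit_ball_vol_gt0// exprn_gt0// mulr_gt0//.
  exact: density_radius_gt0.
have uk k : u <= w / 2 * (eps * r) ^+ n * 2^-1 ^+ k.
  have q0 : 0 < 2^-1 ^+ k :> R by rewrite exprn_gt0.
  have q1 : 2^-1 ^+ k <= 1 :> R by rewrite exprn_ile1// invf_le1// ler1n.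
  rewrite -lee_fin -uE.
  apply: (@le_trans _ _ (w / 2 * (eps * r * 2^-1 ^+ k) ^+ n)%:E); last first.
    rewrite lee_fin exprMn mulrA ler_pM2l//.
    (* Here n >= 1 enters: the n-th power of 2^-k is at most 2^-k. *)
    by case: n n_gt0 => // m _; rewrite exprS ger_pMr// exprn_ile1// ltW.
  apply: le_trans (H k); apply: le_measure; rewrite ?inE.
  - by apply: measurableI => //; exact: lebesgue_measurable_eball.
  - by apply: measurableI => //; exact: lebesgue_measurable_eball.
  by apply: classical_sets.setIS; apply: sub_eball; rewrite ler_pMr// lerDl ltW.
set M := w / 2 * (eps * r) ^+ n in M0 uk.
(* This k exceeds M / u, and 2^k exceeds k, so M 2^-k < u. *)
have := uk (Num.truncn (M / u)).+1; apply/negP; rewrite -ltNge.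
rewrite exprVn ltr_pdivrMr ?exprn_gt0// mulrC -ltr_pdivrMr//.
apply: lt_trans (truncnS_gt _) _.
by rewrite -natrX ltr_nat ltn_expl.
Qed.

End density_estimate.

Theorem theorem3p16 (R : realType) (n : nat) (s : R)
    (n_ge1 : (1 <= n)%N) (s_gt0 : 0 < s) (s_lt1 : s < 1) :
  exists2 c : R, 0 < c &
    forall Omega E : set 'rV[R]_n,
      open Omega -> lebesgue_measurable E -> normalized E ->
      (subsolution s E Omega ->
        forall (x : 'rV[R]_n) (r : R), topological_boundary E x ->
          0 < r -> eball x r `<=` Omega ->
          ((c * r ^+ n)%:E <= vol (E `&` eball x r))%E)
      /\
      (s_minimal s E Omega ->
        forall (x : 'rV[R]_n) (r : R), topological_boundary E x ->
          0 < r -> eball x r `<=` Omega ->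
          ((c * r ^+ n)%:E <= vol (E `&` eball x r))%E /\
          ((c * r ^+ n)%:E <= vol (~` E `&` eball x r))%E).
Proof.
exists (@density_cst R n s); first exact: density_cst_gt0.
move=> Omega E oO mE [_ _ bE].
have sub_case : subsolution s E Omega ->
    forall (x : 'rV[R]_n) (r : R), topological_boundary E x ->
      0 < r -> eball x r `<=` Omega ->
      ((@density_cst R n s * r ^+ n)%:E <= vol (E `&` eball x r))%E.
  move=> subE x r; rewrite bE => bx r0 BO.
  apply: (density_estimate n_ge1 s_gt0 s_lt1 mE subE BO r0).
  (* The boundary condition is used at radius r / 2, where [density_estimate] asks for positive
     volume. *)
  by have /andP[] := bx (r / 2) (divr_gt0 r0 (ltr0Sn _ 1)).
split=> // minE x r bx r0 BO; split.
  exact: (sub_case (s_minimal_subsolution oO mE minE)).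
have mCE : lebesgue_measurable (~` E) by exact: measurableC.
have subCE := s_minimal_subsolution oO mCE (s_minimalC oO mE minE).
apply: (density_estimate n_ge1 s_gt0 s_lt1 mCE subCE BO r0).
have r20 : 0 < r / 2 by rewrite divr_gt0.
move: bx; rewrite bE => /(_ _ r20)/andP[_]; rewrite -(vol_eball x r20) => vlt.
(* If the complement had volume zero in the half ball, [E] would have the full volume of that ball,
   against the upper bound at a boundary point. *)
rewrite lt0e measure_ge0 andbT; apply/eqP => v0.
have mB := @lebesgue_measurable_eball R n x (r / 2).
move: vlt; rewrite ltNge => /negP; apply.
have H : (vol (E `&` eball x (r / 2) `|` ~` E `&` eball x (r / 2)) <=
  vol (E `&` eball x (r / 2)) + vol (~` E `&` eball x (r / 2)))%E.
  exact: (@measureU2 _ _ R (lebesgue_rV R n) _ _ (measurableI _ _ mE mB)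
    (measurableI _ _ mCE mB)).
rewrite v0 adde0 in H; apply: le_trans H.
by rewrite -setIUl setUv setTI.
Qed.
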